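(* Let $H=H_0\tau_z+H_M+\Delta'\tau_x$ be the Bogoliubov–de Gennes Hamiltonian of an $s$-wave system with Zeeman field as defined in the context, with local pairing magnitudes $\Delta_i\ge 0$ and local Zeeman energies $B_i\ge 0$ on the sites $i=1,\dots,n$ of the unit cell, and with an arbitrary translation-invariant time-reversal-even Hermitian $H_0$. Let $E_G$ be the energy gap of $H$. 1. If $\Delta_i-B_i>0$ for all $i$, then $H$ is topologically trivial and $E_G\ge\min_i(\Delta_i-B_i)$. 2. If $E_G>0$ and $\max_i(B_i-\Delta_i)<E_G$, then $H$ is topologically trivial.
   Context: Fix an integer $d\ge 0$ (spatial dimension) and $n\ge1$ sites (including orbitals) per unit cell, each carrying a spin-$1/2$, so the internal space is $\mathbb{C}^n\otimes\mathbb{C}^2$ of dimension $N=2n$. A translation-invariant Hermitian operator is a continuous map $A:\mathbb{T}^d\to\mathbb{C}^{N\times N}$ from the Brillouin torus $\mathbb{T}^d=(\mathbb{R}/2\pi\mathbb{Z})^d$ with $A(k)=A(k)^\dagger$ (for $d=0$ just a Hermitian matrix). Time reversal is $\mathcal{T}=i\sigma_yK$, with $\sigma_{x,y,z}$ the Pauli matrices in spin space and $K$ complex conjugation; it acts by $(\mathcal{T}A\mathcal{T}^{-1})(k)=\sigma_y\overline{A(-k)}\sigma_y$. $A$ is time-reversal even (odd) if $\mathcal{T}A\mathcal{T}^{-1}=A$ (respectively $-A$). $\tau_x,\tau_y,\tau_z$ are the Pauli matrices in particle-hole space $\mathbb{C}^2$; $A\tau_j$ means $\tau_j\otimes A$,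 and $A$ alone means $1_2\otimes A$. A general BdG Hamiltonian is $H=H_0\tau_z+H_M+\Delta'\tau_x+\Delta''\tau_y$, with $H_0,\Delta',\Delta''$ translation-invariant Hermitian time-reversal even and $H_M$ translation-invariant Hermitian time-reversal odd; equivalently, a continuous family of Hermitian $2N\times2N$ matrices with particle-hole symmetry $\mathcal{P}H\mathcal{P}^{-1}=-H$, $\mathcal{P}=i\tau_y\mathcal{T}$. $s$-wave system with Zeeman field: $\Delta''=0$, and $\Delta'$, $H_M$ are $k$-independent and block diagonal in the site index, with site-$i$ blocks $\Delta_i 1_2$ and $B_i\,\mathbf{n}_i\cdot\boldsymbol{\sigma}$ respectively, where $\Delta_i\ge0$ is the local pairing magnitude, $B_i\ge0$ the local Zeeman energy, and $\mathbf{n}_i\in\mathbb{R}^3$ a unit vector (the local field direction). The energy gap of $H$ is $E_G=\min\{|E| : E \text{ an eigenvalue of } H(k) \text{ for some } k\in\mathbb{T}^d\}$; $H$ is gapped if $E_G>0$. A gapped $H$ is topologically trivial if there is a continuous path $s\mapsto H_s$, $s\in[0,1]$ (jointly continuous in $(s,k)$), of gapped general BdG Hamiltonians (hence $\mathcal{P}$-symmetric) from $H$ at $s=0$ to the onsite potential $\tau_z\otimes 1_N$ at $s=1$; if in addition $(1_2\otimes\mathcal{T})H(1_2\otimes\mathcal{T})^{-1}=H$, every Hamiltonian on the path is required to satisfy this as well. *)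

(* Defs.v *)
From mathcomp Require Import all_boot all_order all_algebra.
From mathcomp Require Import sesquilinear.
From mathcomp Require Import all_classical all_reals all_analysis.
From mathcomp Require Import complex mxtens.

Set Implicit Arguments.
Unset Strict Implicit.
Unset Printing Implicit Defensive.

Import Order.TTheory GRing.Theory Num.Theory.
Import numFieldNormedType.Exports.

Local Open Scope classical_set_scope.
Local Open Scope ring_scope.
Local Open Scope complex_scope.
Local Open Scope sesquilinear_scope.

(* The tensor product is mathcomp's [A *t B]: the internal space C^n (x) C^2
   has dimension [n * 2] (site (x) spin), and particle-hole space is the first
   tensor factor, of total dimension [2 * (n * 2)]. *)

Section BdG.
Variable R : realType.

(* The complex numbers, packed as a [numClosedFieldType] so that they carry
   the topology induced by the modulus. *)
Definition Cplx : numClosedFieldType := R[i].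

Definition pauli_x : 'M[Cplx]_2 := delta_mx 0 1 + delta_mx 1 0.
Definition pauli_y : 'M[Cplx]_2 := - 'i *: delta_mx 0 1 + 'i *: delta_mx 1 0.
Definition pauli_z : 'M[Cplx]_2 := delta_mx 0 0 - delta_mx 1 1.

Definition conj_mx m n (A : 'M[Cplx]_(m, n)) : 'M[Cplx]_(m, n) :=
  map_mx Num.conj A.

Variable d : nat.

(* A map on the Brillouin torus (R / 2 pi Z)^d is given by its lift to R^d,
   i.e. by a map that is 2 pi-periodic in each coordinate. *)
Definition torus_periodic (T : Type) (f : 'rV[R]_d -> T) : Prop :=
  forall (k : 'rV[R]_d) (a : 'I_d), f (k + (2 * pi) *: delta_mx 0 a) = f k.

Definition ti_hermitian m (A : 'rV[R]_d -> 'M[Cplx]_m) : Prop :=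
  [/\ continuous A, torus_periodic A & forall k, A k \is hermsymmx].

Variable n : nat.

Definition sigma_y : 'M[Cplx]_(n * 2) := 1%:M *t pauli_y.

(* T A T^-1 for T = i sigma_y K *)
Definition time_reversal (A : 'rV[R]_d -> 'M[Cplx]_(n * 2)) (k : 'rV[R]_d) :
    'M[Cplx]_(n * 2) :=
  sigma_y *m conj_mx (A (- k)) *m sigma_y.

Definition tr_even (A : 'rV[R]_d -> 'M[Cplx]_(n * 2)) : Prop :=
  time_reversal A = A.

Definition tr_odd (A : 'rV[R]_d -> 'M[Cplx]_(n * 2)) : Prop :=
  time_reversal A = (fun k => - A k).

Definition BdG_form (H0 HM D1 D2 : 'rV[R]_d -> 'M[Cplx]_(n * 2))
    (k : 'rV[R]_d) : 'M[Cplx]_(2 * (n * 2)) :=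
  pauli_z *t H0 k + 1%:M *t HM k + pauli_x *t D1 k + pauli_y *t D2 k.

Definition BdG_hamiltonian (H : 'rV[R]_d -> 'M[Cplx]_(2 * (n * 2))) : Prop :=
  exists H0 HM D1 D2 : 'rV[R]_d -> 'M[Cplx]_(n * 2),
    [/\ ti_hermitian H0 /\ tr_even H0, ti_hermitian HM /\ tr_odd HM,
        ti_hermitian D1 /\ tr_even D1, ti_hermitian D2 /\ tr_even D2
      & H = BdG_form H0 HM D1 D2].

(* (1_2 (x) T) H (1_2 (x) T)^-1 *)
Definition BdG_time_reversal (H : 'rV[R]_d -> 'M[Cplx]_(2 * (n * 2)))
    (k : 'rV[R]_d) : 'M[Cplx]_(2 * (n * 2)) :=
  (1%:M *t sigma_y) *m conj_mx (H (- k)) *m (1%:M *t sigma_y).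

Definition BdG_tr_symmetric (H : 'rV[R]_d -> 'M[Cplx]_(2 * (n * 2))) : Prop :=
  BdG_time_reversal H = H.

Definition abs_energies (H : 'rV[R]_d -> 'M[Cplx]_(2 * (n * 2))) : set R :=
  [set ComplexField.Normc.normc E | E in [set E : R[i] | exists k, eigenvalue (H k) E]].

(* The minimum of [abs_energies H], which exists for every continuous periodic
   [H] when 0 < n; [xget] returns 0 if there is none. *)
Definition energy_gap (H : 'rV[R]_d -> 'M[Cplx]_(2 * (n * 2))) : R :=
  xget 0 [set E | abs_energies H E /\ lbound (abs_energies H) E].

Definition gapped (H : 'rV[R]_d -> 'M[Cplx]_(2 * (n * 2))) : Prop :=
  0 < energy_gap H.

Definition onsite_potential (_ : 'rV[R]_d) : 'M[Cplx]_(2 * (n * 2)) :=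
  pauli_z *t 1%:M.

(* The path is a function on all of R of which only the restriction to [0, 1]
   matters. *)
Definition topologically_trivial (H : 'rV[R]_d -> 'M[Cplx]_(2 * (n * 2))) :
    Prop :=
  gapped H /\
  exists Hs : R -> 'rV[R]_d -> 'M[Cplx]_(2 * (n * 2)),
    [/\ {within `[0, 1]%classic `*` [set: 'rV[R]_d],
           continuous (fun sk : R * 'rV[R]_d => Hs sk.1 sk.2)},
        forall s, s \in `[0, 1] -> BdG_hamiltonian (Hs s) /\ gapped (Hs s),
        Hs 0 = H /\ Hs 1 = onsite_potential
      & BdG_tr_symmetric H ->
        forall s, s \in `[0, 1] -> BdG_tr_symmetric (Hs s)].

Definition unit_vector (v : 'rV[R]_3) : Prop := \sum_(a < 3) v 0 a ^+ 2 = 1.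

(* v . sigma, acting on a single spin *)
Definition dot_sigma (v : 'rV[R]_3) : 'M[Cplx]_2 :=
  (v 0 0)%:C *: pauli_x + (v 0 1)%:C *: pauli_y + (v 0 2)%:C *: pauli_z.

Definition site_diag (M : 'I_n -> 'M[Cplx]_2) : 'M[Cplx]_(n * 2) :=
  \sum_(i < n) delta_mx i i *t M i.

Definition pairing (Delta : 'I_n -> R) : 'rV[R]_d -> 'M[Cplx]_(n * 2) :=
  fun=> site_diag (fun i => (Delta i)%:C%:M).

Definition zeeman (B : 'I_n -> R) (nv : 'I_n -> 'rV[R]_3) :
    'rV[R]_d -> 'M[Cplx]_(n * 2) :=
  fun=> site_diag (fun i => (B i)%:C *: dot_sigma (nv i)).

Definition swave_hamiltonian (H0 : 'rV[R]_d -> 'M[Cplx]_(n * 2))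
    (Delta B : 'I_n -> R) (nv : 'I_n -> 'rV[R]_3) :
    'rV[R]_d -> 'M[Cplx]_(2 * (n * 2)) :=
  BdG_form H0 (zeeman B nv) (pairing Delta) (fun=> 0).

Definition min_site (n_gt0 : (0 < n)%N) (f : 'I_n -> R) : R :=
  \big[Num.min/f (Ordinal n_gt0)]_(i < n) f i.

Definition max_site (n_gt0 : (0 < n)%N) (f : 'I_n -> R) : R :=
  \big[Num.max/f (Ordinal n_gt0)]_(i < n) f i.

End BdG.

(* Main.v *)
Require Import Defs.
From HB Require Import structures.
From mathcomp Require Import all_boot all_order all_algebra.
From mathcomp Require Import perm sesquilinear spectral.
From mathcomp Require Import all_classical all_reals all_analysis.
From mathcomp Require Import complex mxtens ring lra.

(** The matrix [tau_x] anticommutes with [H_0 tau_z] and commutes with [H_M], so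
    the anticommutator of [H] and [tau_x] is [2 (Delta + H_M tau_x)], at least
    [2 min_i (Delta_i - B_i)] as a quadratic form. On a normalized eigenvector
    of [H] with eigenvalue [E] it is at most [2 |E|], which gives the gap bound
    of part 1. The straight line from [H] to [tau_z] stays within [s]-wave
    systems with pairings [(1 - s) Delta_i] and Zeeman energies [(1 - s) B_i],
    so the same bound keeps it gapped for [s < 1].

    In part 2, take [c >= 0] with [max_i (B_i - Delta_i) < c < E_G]. By the
    spectral theorem [H + t tau_x] has gap at least [E_G - t], so the path from
    [H] to [H + c tau_x] is gapped, and its endpoint, an [s]-wave system with
    pairings [Delta_i + c], satisfies the hypothesis of part 1. *)

Set Implicit Arguments.
Unset Strict Implicit.
Unset Printing Implicit Defensive.

Import Order.TTheory GRing.Theory Num.Theory.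
Import numFieldNormedType.Exports.

Local Open Scope classical_set_scope.
Local Open Scope ring_scope.
Local Open Scope sesquilinear_scope.

(** * Quadratic forms and eigenvalue bounds *)

Section QuadraticForm.
Variable C : numClosedFieldType.

Lemma hermsymmxP m (M : 'M[C]_m) : reflect (M^t* = M) (M \is hermsymmx).
Proof.
apply: (iffP (is_hermitianmxP _ _ _)); rewrite expr0 scale1r; by move=> /esym.
Qed.

Variable m : nat.
Implicit Types (v : 'rV[C]_m) (M A X P Q : 'M[C]_m).

(** Vectors are rows, in keeping with [eigenvalue], which refers to left eigenvectors. *)
Definition qform v M : C := (v *m M *m v^t*) 0 0.

Lemma qformD v M1 M2 : qform v (M1 + M2) = qform v M1 + qform v M2.
Proof. by rewrite /qform mulmxDr mulmxDl mxE. Qed.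

Lemma qformZ v a M : qform v (a *: M) = a * qform v M.
Proof. by rewrite /qform -scalemxAr -scalemxAl mxE. Qed.

Lemma qformN v M : qform v (- M) = - qform v M.
Proof. by rewrite -scaleN1r qformZ mulN1r. Qed.

Lemma qform_real v M : M^t* = M -> qform v M \is Num.real.
Proof.
move=> hM; apply/CrealP; transitivity ((v *m M *m v^t*)^t* 0 0).
  by rewrite [RHS]mxE [X in _ = _ X]mxE.
by rewrite !trmx_mul !map_mxM trmxCK hM mulmxA.
Qed.

Lemma qform_gram_ge0 v A : 0 <= qform v (A *m A^t*).
Proof.
rewrite /qform mulmxA -mulmxA -map_mxM -trmx_mul mxE.
by apply: sumr_ge0 => i _; rewrite !mxE mul_conjC_ge0.
Qed.

Lemma qform1_ge0 v : 0 <= qform v 1%:M.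
Proof. by have := qform_gram_ge0 v 1%:M; rewrite trmx1 map_mx1 mulmx1. Qed.

Lemma qform1_gt0 v : v != 0 -> 0 < qform v 1%:M.
Proof.
move=> v0; rewrite lt_neqAle qform1_ge0 andbT eq_sym.
apply: contra v0 => /eqP; rewrite /qform mulmx1 mxE.
under eq_bigr do rewrite !mxE -normCK.
move=> /eqP; rewrite psumr_eq0 => [|i _]; last exact: exprn_ge0.
move=> /allP v0; apply/eqP/rowP => i; rewrite mxE.
by apply/eqP; rewrite -normr_eq0 -sqrf_eq0; apply: v0; rewrite mem_index_enum.
Qed.

(** In the partial order of [C], [0 <= x] also says that [x] is real, so such an [M] is
    Hermitian. *)
Definition psdmx M := forall v, 0 <= qform v M.

Lemma psdmxD M1 M2 : psdmx M1 -> psdmx M2 -> psdmx (M1 + M2).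
Proof. by move=> p1 p2 v; rewrite qformD addr_ge0. Qed.

Lemma psdmxZ a M : 0 <= a -> psdmx M -> psdmx (a *: M).
Proof. by move=> a0 p v; rewrite qformZ mulr_ge0. Qed.

Lemma psdmx_sum (I : finType) (F : I -> 'M[C]_m) :
  (forall i, psdmx (F i)) -> psdmx (\sum_i F i).
Proof.
move=> p; apply: (big_ind psdmx) => [v||//]; last exact: psdmxD.
by rewrite /qform mulmx0 mul0mx mxE.
Qed.

(* (P + Q)^2 = 2 (P + Q) *)
Lemma psdmx_proj_symm P Q : P^t* = P -> Q^t* = Q ->
  P *m P = P -> Q *m Q = P -> P *m Q = Q -> Q *m P = Q -> psdmx (P + Q).
Proof.
move=> hP hQ PP QQ PQ QP v.
have -> : P + Q = 2^-1 *: ((P + Q) *m (P + Q)^t*).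
  rewrite linearD /= map_mxD hP hQ mulmxDl !mulmxDr PP QQ PQ QP.
  have -> : P + Q + (Q + P) = 2 *: (P + Q).
    by rewrite [Q + P]addrC scaler_nat mulr2n.
  by rewrite scalerA mulVf ?scale1r ?pnatr_eq0.
by rewrite qformZ mulr_ge0 ?invr_ge0 ?ler0n // qform_gram_ge0.
Qed.

(** Both [1 + X] and [1 - X] have the shape [P + Q] of [psdmx_proj_symm] with [P = 1], hence are
    positive. *)
Lemma qform_involution_le v X : X^t* = X -> X *m X = 1%:M ->
  `|qform v X| <= qform v 1%:M.
Proof.
move=> hX XX.
have h1 : (1%:M : 'M[C]_m)^t* = 1%:M by rewrite trmx1 map_mx1.
have p1 : psdmx (1%:M + X) by apply: psdmx_proj_symm; rewrite ?mulmx1 ?mul1mx.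
have p2 : psdmx (1%:M - X).
  apply: psdmx_proj_symm; rewrite ?mulmx1 ?mul1mx ?mulmxN ?mulNmx ?opprK //.
  by rewrite linearN /= map_mxN hX.
move: (p1 v) (p2 v); rewrite !qformD qformN => q1 q2.
rewrite real_ler_norml ?qform_real //; apply/andP; split.
  by rewrite -subr_ge0 opprK addrC.
by rewrite -subr_ge0.
Qed.

Lemma eigenvector_trmxC v H E : H^t* = H -> v *m H = E *: v ->
  H *m v^t* = E^* *: v^t*.
Proof.
move=> hH /(congr1 (fun u => u^t*)).
by rewrite trmx_mul map_mxM hH linearZ /= map_mxZ.
Qed.

(** The factor [E + E^*] is twice the real part of [E]. In both uses [x] is the form of an
    involution at an eigenvector and [N] the squared norm of that vector. *)
Lemma norm_addrJ_mul_le (E x N : C) : `|x| <= N ->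
  `|(E + E^*) * x| <= 2 * `|E| * N.
Proof.
move=> xN; rewrite normrM ler_pM // (le_trans (ler_normD _ _)) // norm_conjC.
by rewrite mulr_natl mulr2n.
Qed.

(** The eigenvalue equation and its adjoint turn the form of [H *m X + X *m H] at an eigenvector [v]
    into [2 Re E] times [qform v X], which is at most [2 |E|] times the squared norm of [v]. *)
Lemma anticomm_eigenvalue_ge (H X : 'M[C]_m) (g E : C) :
  H^t* = H -> X^t* = X -> X *m X = 1%:M -> g \is Num.real ->
  psdmx (H *m X + X *m H - (2 * g)%:M) -> eigenvalue H E -> g <= `|E|.
Proof.
move=> hH hX XX gr p /eigenvalueP [v vH v0].
have N0 := qform1_gt0 v0; have := p v.
rewrite !qformD qformN -scalemx1 qformZ.
have -> : qform v (H *m X) = E * qform v X.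
  by rewrite /qform mulmxA vH -!scalemxAl mxE.
have -> : qform v (X *m H) = E^* * qform v X.
  rewrite /qform -!mulmxA (eigenvector_trmxC hH vH).
  by rewrite -!scalemxAr mxE mulmxA.
rewrite -mulrDl subr_ge0 => le1.
have le2 := norm_addrJ_mul_le E (qform_involution_le v hX XX).
have le3 : 2 * g * qform v 1%:M <= 2 * `|E| * qform v 1%:M.
  apply: le_trans le2; apply: (le_trans le1).
  have r1 : 2 * g * qform v 1%:M \is Num.real.
    by rewrite !rpredM ?realn ?(ger0_real (ltW N0)).
  (* The larger side of [le1] is real because it differs from a real number by a nonnegative one. *)
  apply: real_ler_norm; rewrite -(subrK (2 * g * qform v 1%:M) (_ * _)).
  by rewrite rpredD ?r1 // ger0_real // subr_ge0.
by move: le3; rewrite ler_pM2r // ler_pM2l.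
Qed.

Lemma spectral_diag_eigenvalue A i : A \is normalmx ->
  eigenvalue A (spectral_diag A 0 i).
Proof.
move=> /orthomx_spectralP eA; apply/eigenvalueP.
exists (row i (spectralmx A)).
  rewrite [X in _ *m X]eA -row_mul !mulmxA mulmxV ?spectral_unit // mul1mx.
  by rewrite mul_diag_mx; apply/rowP => j; rewrite !mxE.
(* A row of a unitary matrix has norm one, as the diagonal of the unitarity relation shows, so it is
   nonzero. *)
have /unitarymxP/(congr1 (fun M => M i i)) := spectral_unitarymx A.
rewrite mxE [RHS]mxE eqxx => e; apply/eqP => /rowP r0; move: e.
rewrite big1 => [|j _]; first by move=> /esym/eqP; rewrite oner_eq0.
by have := r0 j; rewrite !mxE => ->; rewrite mul0r.
Qed.

(** In an orthonormal eigenbasis the matrix is diagonal with entries [|E|^2 - g^2], one for each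
    eigenvalue [E] of [A]. *)
Lemma psdmx_sqr_eigenvalue_ge A (g : C) : A^t* = A -> 0 <= g ->
  (forall E, eigenvalue A E -> g <= `|E|) ->
  psdmx (A *m A - (g ^+ 2)%:M).
Proof.
move=> hA g0 gE v.
have nA : A \is normalmx by apply/normalmxP; rewrite hA.
have /orthomx_spectralP eA := nA.
have uP := spectral_unitarymx A.
have := fun i => spectral_diag_eigenvalue i nA.
move: (spectralmx A) (spectral_diag A) uP eA => P sp uP eA spE.
have eAA : A *m A - (g ^+ 2)%:M =
    P^t* *m diag_mx (\row_i (`|sp 0 i| ^+ 2 - g ^+ 2)) *m P.
  have -> : diag_mx (\row_i (`|sp 0 i| ^+ 2 - g ^+ 2)) =
      diag_mx sp *m (diag_mx sp)^t* - (g ^+ 2)%:M.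
    apply/matrixP => i j; rewrite tr_diag_mx map_diag_mx mulmx_diag !mxE.
    by rewrite normCK -mulrnBl.
  rewrite mulmxBr mulmxBl mul_mx_scalar -scalemxAl -invmx_unitary //.
  rewrite mulVmx ?unitarymx_unit // scalemx1; congr (_ - _).
  (* Replacing the second factor [A] by its adjoint makes each eigenvalue meet its conjugate, whence
     the squared moduli. *)
  rewrite -{2}hA {1 2}eA !trmx_mul !map_mxM invmx_unitary // trmxCK.
  rewrite -!mulmxA; do 2 congr (_ *m _).
  by rewrite !mulmxA (unitarymxP _) // mul1mx.
rewrite eAA /qform; set D := diag_mx _.
have -> : v *m (P^t* *m D *m P) *m v^t* = (v *m P^t*) *m D *m (v *m P^t*)^t*.
  by rewrite trmx_mul map_mxM trmxCK !mulmxA.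
move: (v *m P^t*) => w; rewrite mxE; apply: sumr_ge0 => i _.
rewrite mul_mx_diag !mxE mulrAC mulr_ge0 ?mul_conjC_ge0 // subr_ge0.
by rewrite ler_pXn2r ?nnegrE ?gE ?spE.
Qed.

(** A bound of Weyl type. An eigenvector [v] of [A + c X] satisfies [v A = E v - c v X], so the
    squared norm of [v A] is at most [(|E| + c)^2] times that of [v]; the spectral bound on [A]
    makes it at least [g^2] times that of [v]. *)
Lemma shifted_eigenvalue_ge A X (g c E : C) :
  A^t* = A -> X^t* = X -> X *m X = 1%:M -> 0 <= g -> 0 <= c ->
  (forall E', eigenvalue A E' -> g <= `|E'|) ->
  eigenvalue (A + c *: X) E -> g - c <= `|E|.
Proof.
move=> hA hX XX g0 c0 gE /eigenvalueP [v vH v0].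
have N0 := qform1_gt0 v0.
have cR : c^* = c by apply/CrealP/ger0_real.
have vA : v *m A = E *: v - c *: (v *m X).
  by rewrite -vH mulmxDr -scalemxAr addrK.
have := psdmx_sqr_eigenvalue_ge hA g0 gE v.
rewrite qformD qformN -scalemx1 qformZ.
have -> : qform v (A *m A) =
    (`|E| ^+ 2 + c ^+ 2) * qform v 1%:M - c * ((E + E^* ) * qform v X).
  have -> : qform v (A *m A) = ((v *m A) *m (v *m A)^t*) 0 0.
    by rewrite trmx_mul map_mxM hA /qform !mulmxA.
  have -> : (v *m A)^t* = E^* *: v^t* - c *: (X *m v^t*).
    rewrite vA linearB /= map_mxB linearZ linearZ /= !map_mxZ trmx_mul map_mxM.
    by rewrite hX /= cR.
  rewrite vA mulmxBl !mulmxBr -!scalemxAl -!scalemxAr !scalerA.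
  have -> : v *m X *m (X *m v^t*) = v *m 1%:M *m v^t*.
    by rewrite -!mulmxA [X *m (X *m _)]mulmxA XX.
  have -> : v *m v^t* = v *m 1%:M *m v^t* by rewrite mulmx1.
  rewrite mulmxA /qform normCK.
  move: (v *m 1%:M *m _) (v *m X *m _) => M1 M2; rewrite !mxE ; ring.
rewrite subr_ge0 => le1.
have le2 := norm_addrJ_mul_le E (qform_involution_le v hX XX).
have le3 : - (c * ((E + E^* ) * qform v X)) <= c * (2 * `|E| * qform v 1%:M).
  rewrite -mulrN; apply: ler_wpM2l => //.
  apply: le_trans le2; rewrite -normrN; apply: real_ler_norm.
  rewrite rpredN rpredM ?qform_real //; apply/CrealP.
  by rewrite rmorphD /= conjCK addrC.
have : g ^+ 2 * qform v 1%:M <= (`|E| + c) ^+ 2 * qform v 1%:M.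
  apply: (le_trans le1); rewrite -subr_ge0 in le3; rewrite -subr_ge0.
  move: le3; congr (0 <= _); ring.
rewrite ler_pM2r // ler_pXn2r ?nnegrE ?addr_ge0 // => le4.
by rewrite lerBlDr.
Qed.
End QuadraticForm.

(** * Tensor products and Pauli matrices *)

Section Tensor.
Variable C : numClosedFieldType.

Lemma tensmxDr m n p q (A : 'M[C]_(m, n)) (B1 B2 : 'M[C]_(p, q)) :
  A *t (B1 + B2) = A *t B1 + A *t B2.
Proof. by apply/matrixP => i j; rewrite !mxE mulrDr. Qed.

Lemma tensmxDl m n p q (A1 A2 : 'M[C]_(m, n)) (B : 'M[C]_(p, q)) :
  (A1 + A2) *t B = A1 *t B + A2 *t B.
Proof. by apply/matrixP => i j; rewrite !mxE mulrDl. Qed.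

Lemma tensmxZr m n p q a (A : 'M[C]_(m, n)) (B : 'M[C]_(p, q)) :
  A *t (a *: B) = a *: (A *t B).
Proof. by apply/matrixP => i j; rewrite !mxE mulrCA. Qed.

Lemma tensmxNr m n p q (A : 'M[C]_(m, n)) (B : 'M[C]_(p, q)) :
  A *t (- B) = - (A *t B).
Proof. by rewrite -scaleN1r tensmxZr scaleN1r. Qed.

Lemma tensmx_sumr (I : finType) m n p q (A : 'M[C]_(m, n))
    (F : I -> 'M[C]_(p, q)) :
  A *t (\sum_i F i) = \sum_i A *t F i.
Proof.
apply: (big_morph (fun B => A *t B)); last exact: tensmx0.
exact: tensmxDr.
Qed.

Lemma trmxC_tens m n p q (A : 'M[C]_(m, n)) (B : 'M[C]_(p, q)) :
  (A *t B)^t* = A^t* *t B^t*.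
Proof. by rewrite trmx_tens map_mxT. Qed.

Lemma tens1mx1 m n : (1%:M : 'M[C]_m) *t (1%:M : 'M[C]_n) = 1%:M.
Proof.
apply/matrixP => i j.
case: (mxtens_indexP i) => i0 i1; case: (mxtens_indexP j) => j0 j1.
rewrite tensmxE !mxE -natrM mulnb; congr (_%:R); congr nat_of_bool.
rewrite (can_eq (@mxtens_indexK m n)) //.
Qed.

Lemma sum_delta_tens1 m n :
  \sum_(i < m) delta_mx i i *t (1%:M : 'M[C]_n) = 1%:M.
Proof.
rewrite -tens1mx1 [X in X *t _]mx1_sum_delta; symmetry.
apply: (big_morph (fun A : 'M[C]_m => A *t (1%:M : 'M[C]_n))).
  by move=> A B; rewrite tensmxDl.
exact: tens0mx.
Qed.

End Tensor.

Section Pauli.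
Variable R : realType.
Local Notation K := (Cplx R).

Lemma pauli_x_herm : (pauli_x R)^t* = pauli_x R.
Proof.
apply/matrixP; case=> [[|[|//]] ?]; case=> [[|[|//]] ?];
  rewrite !mxE /= rmorphD /= ?rmorph0 ?rmorph1; ring.
Qed.

Lemma pauli_z_herm : (pauli_z R)^t* = pauli_z R.
Proof.
apply/matrixP; case=> [[|[|//]] ?]; case=> [[|[|//]] ?];
  rewrite !mxE /= rmorphB /= ?rmorph0 ?rmorph1; ring.
Qed.

Lemma pauli_x_sqr : pauli_x R *m pauli_x R = 1%:M.
Proof.
apply/matrixP; case=> [[|[|//]] ?]; case=> [[|[|//]] ?];
  rewrite !mxE !big_ord_recl big_ord0 !mxE /=; ring.
Qed.

Lemma pauli_z_sqr : pauli_z R *m pauli_z R = 1%:M.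
Proof.
apply/matrixP; case=> [[|[|//]] ?]; case=> [[|[|//]] ?];
  rewrite !mxE !big_ord_recl big_ord0 !mxE /=; ring.
Qed.

Lemma pauli_y_sqr : pauli_y R *m pauli_y R = 1%:M.
Proof.
have i2 := sqrCi K.
apply/matrixP; case=> [[|[|//]] ?]; case=> [[|[|//]] ?];
  rewrite !mxE !big_ord_recl big_ord0 !mxE /=; ring: i2.
Qed.

Lemma pauli_zx_anticomm :
  pauli_z R *m pauli_x R + pauli_x R *m pauli_z R = 0.
Proof.
apply/matrixP; case=> [[|[|//]] ?]; case=> [[|[|//]] ?];
  rewrite !mxE !big_ord_recl !big_ord0 !mxE /=; ring.
Qed.

Lemma conj_complex (x : R) : (x%:C%C : K)^* = x%:C%C.
Proof. exact: conjc_real. Qed.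

Lemma dot_sigma_entries (v : 'rV[R]_3) (i j : 'I_2) :
  dot_sigma v i j =
    if i == 0 then if j == 0 then (v 0 2)%:C%C
                   else (v 0 0)%:C%C - 'i * (v 0 1)%:C%C
    else if j == 0 then (v 0 0)%:C%C + 'i * (v 0 1)%:C%C
         else - (v 0 2)%:C%C :> K.
Proof.
move: i j; case=> [[|[|//]] ?]; case=> [[|[|//]] ?]; rewrite !mxE /=; ring.
Qed.

Lemma dot_sigma_herm (v : 'rV[R]_3) : (dot_sigma v)^t* = dot_sigma v.
Proof.
apply/matrixP => i j; rewrite mxE mxE !dot_sigma_entries.
move: i j; case=> [[|[|//]] ?]; case=> [[|[|//]] ?] /=;
  rewrite ?rmorphN ?rmorphD ?rmorphN ?rmorphM /= ?conjCi !conj_complex //; ring.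
Qed.

Lemma dot_sigma_sqr (v : 'rV[R]_3) : unit_vector v ->
  dot_sigma v *m dot_sigma v = 1%:M.
Proof.
rewrite /unit_vector !big_ord_recl big_ord0.
have -> : lift ord0 (lift ord0 ord0) = 2 :> 'I_3 by apply: val_inj.
have -> : lift ord0 ord0 = 1 :> 'I_3 by apply: val_inj.
move=> /(congr1 (real_complex R)).
rewrite addr0 !rmorphD !rmorphXn /= rmorph1 => /(canRL (addrK _)) u.
have i2 := sqrCi K.
apply/matrixP; case=> [[|[|//]] ?]; case=> [[|[|//]] ?];
  rewrite !mxE !big_ord_recl big_ord0 !dot_sigma_entries /=; ring: u i2.
Qed.

(* Both sides are the adjugate of [M]. *)
Lemma pauli_y_conj_tr (M : 'M[K]_2) :
  pauli_y R *m M^T *m pauli_y R = (\tr M)%:M - M.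
Proof.
have i2 := sqrCi K.
have yE (i j : 'I_2) : pauli_y R i j =
    if i == j then 0 else if i == 0 then - 'i else 'i.
  by move: i j; case=> [[|[|//]] ?]; case=> [[|[|//]] ?]; rewrite !mxE /=; ring.
have e0 : ord0 = 0 :> 'I_2 by [].
have e1 : lift ord0 ord0 = 1 :> 'I_2 by apply: val_inj.
have ord2 (i : 'I_2) : i = 0 \/ i = 1.
  by case: i => [[|[|//]] ?]; [left|right]; apply: val_inj.
apply/matrixP => i j; rewrite !mxE /mxtrace !big_ord_recl !big_ord0 !mxE.
rewrite !big_ord_recl !big_ord0 !yE [M^T]lock !e0 !e1 -lock.
by case: (ord2 i) (ord2 j) => -> [] -> /=; rewrite !mxE; ring: i2.
Qed.

(** Hermiticity turns conjugation into transposition, and [dot_sigma v] is traceless, so only the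
    minus sign of [pauli_y_conj_tr] remains: spin is odd under time reversal. *)
Lemma pauli_y_conj_dot_sigma (v : 'rV[R]_3) :
  pauli_y R *m conj_mx (dot_sigma v) *m pauli_y R = - dot_sigma v.
Proof.
have -> : conj_mx (dot_sigma v) = (dot_sigma v)^T.
  by rewrite -{1}(dot_sigma_herm v) /conj_mx map_mxCK.
rewrite pauli_y_conj_tr /mxtrace !big_ord_recl big_ord0 !dot_sigma_entries /=.
by rewrite addr0 subrr raddf0 sub0r.
Qed.

End Pauli.

(** * Algebra of s-wave Hamiltonians *)

(** Serves at a single site, with [x], [y], [z] the pairing, the Zeeman energy and the gap bound, to
    single out the positive matrix [p + q]. *)
Lemma scale_split (C : pzRingType) (V : lmodType C) (x y z : C) (p q : V) :
  x *: p + y *: q - z *: p = (x - y - z) *: p + y *: (p + q).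
Proof.
by rewrite !scalerBl scalerDr addrA [_ - _ *: p + _]addrAC subrK addrAC.
Qed.

Section SiteDiagonal.
Variables (R : realType) (n : nat).
Local Notation K := (Cplx R).
Implicit Types (M : 'I_n -> 'M[K]_2) (Delta B : 'I_n -> R).
Implicit Types (nv : 'I_n -> 'rV[R]_3).

Lemma site_diag_trmxC M : (forall i, (M i)^t* = M i) ->
  (site_diag M)^t* = site_diag M.
Proof.
move=> hM; rewrite /site_diag !raddf_sum /=; apply: eq_bigr => i _.
by rewrite trmxC_tens hM trmx_delta map_delta_mx.
Qed.

Lemma site_diagZ a M : site_diag (fun i => a *: M i) = a *: site_diag M.
Proof.
by rewrite /site_diag scaler_sumr; apply: eq_bigr => i _; rewrite tensmxZr.
Qed.

Lemma site_diagD M1 M2 :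
  site_diag (fun i => M1 i + M2 i) = site_diag M1 + site_diag M2.
Proof.
by rewrite /site_diag -big_split; apply: eq_bigr => i _; rewrite tensmxDr.
Qed.

Lemma site_diag1 : site_diag (fun=> 1%:M : 'M[K]_2) = 1%:M :> 'M[K]_(n * 2).
Proof. exact: sum_delta_tens1. Qed.

Lemma sigma_y_conj_site_diag M :
  sigma_y R n *m conj_mx (site_diag M) *m sigma_y R n =
  site_diag (fun i => pauli_y R *m conj_mx (M i) *m pauli_y R).
Proof.
rewrite /site_diag /conj_mx raddf_sum mulmx_sumr mulmx_suml /=.
apply: eq_bigr => i _; rewrite /sigma_y map_mxT !tensmx_mul mul1mx mulmx1.
by rewrite map_delta_mx.
Qed.

Lemma sigma_y_sqr : sigma_y R n *m sigma_y R n = 1%:M.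
Proof. by rewrite /sigma_y tensmx_mul mulmx1 pauli_y_sqr tens1mx1. Qed.

Lemma const_ti_hermitian d m (A : 'M[K]_m) : A^t* = A ->
  ti_hermitian (fun _ : 'rV[R]_d => A).
Proof.
by move=> hA; split; [exact: cst_continuous| |move=> k; exact/hermsymmxP].
Qed.

Variable d : nat.

Lemma zeeman_ti_hermitian B nv : ti_hermitian (zeeman (d := d) B nv).
Proof.
apply: const_ti_hermitian; apply: site_diag_trmxC => i.
by rewrite linearZ /= map_mxZ /= dot_sigma_herm conj_complex.
Qed.

Lemma zeeman_tr_odd B nv : tr_odd (zeeman (d := d) B nv).
Proof.
apply/funext => k; rewrite /time_reversal /zeeman sigma_y_conj_site_diag.
rewrite -scaleN1r -site_diagZ; congr site_diag; apply/funext => i.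
rewrite /conj_mx map_mxZ /= conj_complex -scalemxAr -scalemxAl.
by rewrite pauli_y_conj_dot_sigma scaleN1r scalerN.
Qed.

Lemma pairing_ti_hermitian Delta :
  ti_hermitian (pairing (d := d) Delta).
Proof.
apply: const_ti_hermitian; apply: site_diag_trmxC => i.
by rewrite tr_scalar_mx map_scalar_mx /= conj_complex.
Qed.

Lemma pairing_tr_even Delta : tr_even (pairing (d := d) Delta).
Proof.
apply/funext => k; rewrite /time_reversal /pairing sigma_y_conj_site_diag.
congr site_diag; apply/funext => i.
rewrite /conj_mx map_scalar_mx /= conj_complex.
by rewrite mul_mx_scalar -scalemxAl pauli_y_sqr scalemx1.
Qed.

Lemma scalar_tr_even (c : R) :
  tr_even (fun _ : 'rV[R]_d => c%:C%C%:M : 'M[K]_(n * 2)).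
Proof.
apply/funext => k.
rewrite /time_reversal /conj_mx map_scalar_mx /= conj_complex.
by rewrite mul_mx_scalar -scalemxAl sigma_y_sqr scalemx1.
Qed.

Lemma swave_BdG (H0 : 'rV[R]_d -> 'M[K]_(n * 2)) Delta B nv :
  ti_hermitian H0 -> tr_even H0 ->
  BdG_hamiltonian (swave_hamiltonian H0 Delta B nv).
Proof.
move=> hH0 eH0.
exists H0, (zeeman B nv), (pairing (d := d) Delta), (fun=> 0); split.
- by [].
- by split; [exact: zeeman_ti_hermitian|exact: zeeman_tr_odd].
- by split; [exact: pairing_ti_hermitian|exact: pairing_tr_even].
- split; first by apply: const_ti_hermitian; rewrite linear0 map_mx0.
  apply/funext => k; rewrite /time_reversal /conj_mx.
  by rewrite (map_mx0 Num.conj) mulmx0 mul0mx.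
- by [].
Qed.

Lemma swaveE (H0 : 'rV[R]_d -> 'M[K]_(n * 2)) Delta B nv k :
  swave_hamiltonian H0 Delta B nv k =
  pauli_z R *t H0 k + 1%:M *t zeeman B nv k + pauli_x R *t pairing Delta k.
Proof.
rewrite /swave_hamiltonian /BdG_form; move: (zeeman B nv k) (pairing Delta k).
by move=> HM D; rewrite tensmx0 addr0.
Qed.

Lemma swave_trmxC (H0 : 'rV[R]_d -> 'M[K]_(n * 2)) Delta B nv k :
  ti_hermitian H0 ->
  (swave_hamiltonian H0 Delta B nv k)^t* = swave_hamiltonian H0 Delta B nv k.
Proof.
have [_ _ hB] := zeeman_ti_hermitian B nv.
have [_ _ hD] := pairing_ti_hermitian Delta.
move=> [_ _ hH0]; rewrite swaveE.
move: (hermsymmxP _ (hB k)) (hermsymmxP _ (hD k)) (hermsymmxP _ (hH0 k)).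
move: (zeeman B nv k) (pairing Delta k) (H0 k) => HM D A hM hD' hA.
rewrite !linearD /= !map_mxD !trmxC_tens hM hD' hA.
by rewrite pauli_x_herm pauli_z_herm trmx1 map_mx1.
Qed.

(** The involution taken as [X] in the eigenvalue bounds. *)
Definition tau_x : 'M[K]_(2 * (n * 2)) := pauli_x R *t 1%:M.

Lemma tau_x_herm : tau_x^t* = tau_x.
Proof. by rewrite trmxC_tens pauli_x_herm trmx1 map_mx1. Qed.

Lemma tau_x_sqr : tau_x *m tau_x = 1%:M.
Proof. by rewrite tensmx_mul pauli_x_sqr mulmx1 tens1mx1. Qed.

(** [H0] cancels because [pauli_z] and [pauli_x] anticommute. As [pauli_x] squares to one, the
    pairing loses its factor [pauli_x] and the Zeeman term gains one. *)
Lemma swave_anticomm (H0 : 'rV[R]_d -> 'M[K]_(n * 2)) Delta B nv k :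
  let H := swave_hamiltonian H0 Delta B nv k in
  H *m tau_x + tau_x *m H =
  2 *: (1%:M *t pairing Delta k + pauli_x R *t zeeman B nv k).
Proof.
move=> H; rewrite /H swaveE /tau_x.
move: (zeeman B nv k) (pairing Delta k) (H0 k) => HM D A.
move: (pauli_x R) (pauli_z R) (pauli_x_sqr R) (pauli_zx_anticomm R).
move=> X Z XX ZX.
rewrite !mulmxDl !mulmxDr !tensmx_mul !mulmx1 !mul1mx XX.
rewrite addrACA [X in X + _]addrACA -tensmxDl ZX.
by rewrite tens0mx add0r -!mulr2n -mulrnDl addrC scaler_nat.
Qed.

(** The matrix splits over the sites. With [P i] the projection onto site [i] and [Q i] the operator
    [pauli_x] times the local spin along the field, [Q i] squares to [P i], so [P i + Q i] is
    positive; it enters with weight [2 B i], and [P i] with the remaining weight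
    [2 (Delta i - B i - g)]. *)
Lemma swave_anticomm_psd (H0 : 'rV[R]_d -> 'M[K]_(n * 2)) Delta B nv k (g : R) :
  (forall i, 0 <= B i) -> (forall i, unit_vector (nv i)) ->
  (forall i, g <= Delta i - B i) ->
  let H := swave_hamiltonian H0 Delta B nv k in
  psdmx (H *m tau_x + tau_x *m H - (2 * g%:C%C)%:M).
Proof.
move=> B0 nv1 gle H; rewrite swave_anticomm.
pose P i : 'M[K]_(2 * (n * 2)) := 1%:M *t (delta_mx i i *t 1%:M).
pose Q i : 'M[K]_(2 * (n * 2)) :=
  pauli_x R *t (delta_mx i i *t dot_sigma (nv i)).
have [hP hQ PP QQ PQ] : [/\ (forall i, (P i)^t* = P i),
    (forall i, (Q i)^t* = Q i), (forall i, P i *m P i = P i),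
    (forall i, Q i *m Q i = P i) &
    (forall i, P i *m Q i = Q i /\ Q i *m P i = Q i)].
  rewrite /P /Q; move: (fun i => dot_sigma_herm (nv i)).
  move: (fun i => dot_sigma_sqr (nv1 i)) (pauli_x_sqr R) (pauli_x_herm R).
  move: (pauli_x R) (fun i => dot_sigma (nv i)) => X S SS XX hX hS.
  split=> i.
  - by rewrite !trmxC_tens trmx_delta map_delta_mx !trmx1 !map_mx1.
  - by rewrite !trmxC_tens trmx_delta map_delta_mx hX hS.
  - by rewrite !tensmx_mul !mulmx1 mul_delta_mx.
  - by rewrite !tensmx_mul XX SS mul_delta_mx.
  - by rewrite !tensmx_mul !mul1mx !mulmx1 mul_delta_mx.
have -> : 2 *: (1%:M *t pairing Delta k + pauli_x R *t zeeman B nv k) -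
    (2 * g%:C%C)%:M = \sum_i (2 *: ((Delta i - B i - g)%:C%C *: P i) +
                              2 *: ((B i)%:C%C *: (P i + Q i))).
  (* The site projections sum to the identity, which distributes the scalar [g] over the sites. *)
  have -> : (2 * g%:C%C)%:M = 2 *: \sum_i g%:C%C *: P i.
    rewrite -scaler_sumr /P -tensmx_sumr sum_delta_tens1 tens1mx1.
    by rewrite scalerA scalemx1.
  rewrite /pairing /zeeman /site_diag !tensmx_sumr -big_split -scalerBr.
  rewrite -sumrB scaler_sumr; apply: eq_bigr => i _ /=.
  rewrite -scalerDr; congr (_ *: _).
  rewrite -[((Delta i)%:C%C)%:M]scalemx1 !tensmxZr -/(P i) -/(Q i).
  rewrite (rmorphB (real_complex R)) (rmorphB (real_complex R)) /=.
  exact: scale_split.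
apply: psdmx_sum => i; apply: psdmxD; do 2 (apply: psdmxZ => //).
- by rewrite ler0c subr_ge0.
- by move=> v; rewrite -[P i]PP -{2}hP; exact: qform_gram_ge0.
- by rewrite ler0c.
- have [PQi QPi] := PQ i.
  exact: (psdmx_proj_symm (hP i) (hQ i) (PP i) (QQ i) PQi QPi).
Qed.

Lemma swave_eigenvalue_ge (H0 : 'rV[R]_d -> 'M[K]_(n * 2)) Delta B nv k (g : R)
    (E : K) : ti_hermitian H0 ->
  (forall i, 0 <= B i) -> (forall i, unit_vector (nv i)) ->
  (forall i, g <= Delta i - B i) ->
  eigenvalue (swave_hamiltonian H0 Delta B nv k) E -> g%:C%C <= `|E|.
Proof.
move=> hH0 B0 nv1 gle; apply: anticomm_eigenvalue_ge (swave_trmxC _ _ _ _ hH0)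
  tau_x_herm tau_x_sqr _ _; last exact: swave_anticomm_psd.
by apply/CrealP; exact: conj_complex.
Qed.

(** [pauli_x] and [pauli_z] are real, so time reversal acts on the three blocks alone and changes
    the sign of the Zeeman one only. Symmetry of an s-wave system thus means that its Zeeman term
    vanishes. *)
Lemma BdG_time_reversal_swave (H0 : 'rV[R]_d -> 'M[K]_(n * 2)) Delta B nv k :
  tr_even H0 ->
  BdG_time_reversal (swave_hamiltonian H0 Delta B nv) k =
  swave_hamiltonian H0 Delta B nv k - 2 *: (1%:M *t zeeman B nv k).
Proof.
move=> eH0; rewrite /BdG_time_reversal !swaveE.
have hA : sigma_y R n *m conj_mx (H0 (- k)) *m sigma_y R n = H0 k.
  exact: (congr1 (fun f => f k) eH0).
have hB : sigma_y R n *m conj_mx (zeeman B nv (- k)) *m sigma_y R n =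
    - zeeman B nv k.
  exact: (congr1 (fun f => f k) (zeeman_tr_odd B nv)).
have hD : sigma_y R n *m conj_mx (pairing Delta (- k)) *m sigma_y R n =
    pairing Delta k.
  exact: (congr1 (fun f => f k) (@pairing_tr_even Delta)).
have hx : conj_mx (pauli_x R) = pauli_x R.
  by apply/matrixP => i j; rewrite !mxE rmorphD /= !conjC_nat.
have hz : conj_mx (pauli_z R) = pauli_z R.
  by apply/matrixP => i j; rewrite !mxE rmorphB /= !conjC_nat.
move: hA hB hD hx hz.
move: (zeeman B nv k) (pairing Delta k) (H0 k) => HM D A.
move: (zeeman B nv _) (pairing Delta _) (H0 _) => HM' D' A'.
move: (pauli_x R) (pauli_z R) (sigma_y R n) => X Z Y hA hB hD hx hz.
have -> : conj_mx (Z *t A' + 1%:M *t HM' + X *t D') =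
    Z *t conj_mx A' + 1%:M *t conj_mx HM' + X *t conj_mx D'.
  by rewrite -{2}hx -{2}hz /conj_mx !map_mxD !map_mxT map_mx1.
rewrite !mulmxDr !mulmxDl !tensmx_mul !mul1mx !mulmx1 hA hB hD tensmxNr.
move: (Z *t A) (1%:M *t HM) (X *t D) => x y z.
by rewrite scaler_nat mulr2n opprD addrA [x + y + z]addrAC addrK addrAC.
Qed.

End SiteDiagonal.

(** * The energy gap is attained *)

Section Continuity.

Lemma continuous_mx (T U : topologicalType) m n (f : T -> 'M[U]_(m, n)) :
  (forall i j, continuous (fun x => f x i j)) -> continuous f.
Proof.
move=> cf x A [P fP sPA].
apply: filterS (_ : nbhs x [set y | forall i j, P i j (f y i j)]).
  by move=> y /= Py; exact: sPA.
apply: filter_forall => i; apply: filter_forall => j.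
exact: (cf i j x _ (fP i j)).
Qed.

(** By the Leibniz expansion into signed products of entries. *)
Lemma continuous_det (T : topologicalType) (K : numFieldType) m
    (f : T -> 'M[K]_m) :
  (forall i j, continuous (fun x => f x i j)) ->
  continuous (fun x => \det (f x)).
Proof.
move=> cf; apply: (@continuous_big _ _ +%R 0) => [|s _ x].
  exact: add_continuous.
apply: cvgM; first exact: cvg_cst.
have := @continuous_big (K : topologicalType) _ ( *%R : K -> K -> K) 1 predT
  (@mul_continuous K) T (index_enum _)
  (fun i x => f x i (s i)) (fun i _ => cf i _).
by apply.
Qed.

Variable R : realType.
Local Notation K := (Cplx R).

Lemma normc_real (x : R) : `|x%:C%C : K| = `|x|%:C%C.
Proof.
have [x0|/ltW x0] := lerP 0 x; first by rewrite !ger0_norm // ler0c.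
by rewrite !ler0_norm // ?rmorphN // -oppr_ge0 -rmorphN ler0c oppr_ge0.
Qed.

Lemma continuous_real_complex : continuous (fun x : R => x%:C%C : K).
Proof.
move=> x; apply/cvgrPdist_lt => e e0.
(* The tolerance [e] is an element of [K]; being positive, it is the image of a real [r]. *)
have /complex_realP[r er] : (e : R[i]) \is Num.real by exact: gtr0_real.
rewrite er ltcR in e0; near=> y.
rewrite -rmorphB normc_real er ltcR.
by near: y; apply: cvgr_dist_lt.
Unshelve. all: by end_near. Qed.

Lemma torus_periodic_int d (T : Type) (f : 'rV[R]_d -> T) k a (m : int) :
  torus_periodic f -> f (k + (2 * pi * m%:~R) *: delta_mx 0 a) = f k.
Proof.
move=> pf; have pn j k' : f (k' + (2 * pi * j%:R) *: delta_mx 0 a) = f k'.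
  elim: j k' => [|j ih] k'; first by rewrite mulr0 scale0r addr0.
  by rewrite -[j.+1%:R]natr1 mulrDr mulr1 scalerDl addrA pf ih.
case: m => j; first exact: pn.
(* A negative translation is undone by the positive one, applied at the translated point. *)
by rewrite NegzE mulrNz mulrN scaleNr -[LHS](pn j.+1) subrK.
Qed.

Lemma torus_periodic_reduce d (T : Type) (f : 'rV[R]_d -> T) k :
  torus_periodic f ->
  exists2 k', f k' = f k & forall i, k' 0 i \in `[0, 2 * pi].
Proof.
move=> pf.
have pi2 : 0 < 2 * pi :> R by rewrite mulr_gt0 ?pi_gt0.
(* Coordinates are reduced one at a time along a list; each reduction leaves the other coordinates
   unchanged. *)
suff /(_ (enum 'I_d)) [k' fk' k'P] :
    forall s : seq 'I_d, exists2 k', f k' = f k &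
    forall i, i \in s -> k' 0 i \in `[0, 2 * pi].
  by exists k' => // i; apply: k'P; rewrite mem_enum.
elim=> [|a s [k' fk' k'P]]; first by exists k.
(* [x] is the coordinate in units of the period; subtracting its floor brings it into the unit
   interval. *)
pose x := k' 0 a / (2 * pi).
exists (k' + (2 * pi * (- Num.floor x)%:~R) *: delta_mx 0 a).
  by rewrite torus_periodic_int.
move=> i; rewrite !mxE /= inE; case: eqVneq => [-> _|_ /= /k'P]; last first.
  by rewrite mulr0 addr0.
have -> : k' 0 a = 2 * pi * x by rewrite mulrC divfK ?gt_eqF.
have /andP[f1 f2] := floor_itv x; rewrite intrD in f2.
rewrite mulr1 -mulrDr rmorphN /= in_itv /= mulr_ge0 ?subr_ge0 ?(ltW pi2) //=.
by rewrite ler_piMr ?(ltW pi2) // lerBlDl ltW.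
Qed.

End Continuity.

(** * Absolute energies as zeros of a continuous function, and existence of their minimum *)

Section EnergyGap.
Variables (R : realType) (d n : nat).
Local Notation K := (Cplx R).
Hypothesis n_gt0 : (0 < n)%N.
Variable H : 'rV[R]_d -> 'M[K]_(2 * (n * 2)).
Hypothesis H_herm : ti_hermitian H.

Lemma det_eigenvalueP m (A : 'M[K]_m) (E : K) :
  reflect (eigenvalue A E) (\det (A - E%:M) == 0).
Proof.
apply: (iffP det0P) => [[v v0 vA]|/eigenvalueP[v vA v0]].
  apply/eigenvalueP; exists v => //; move/eqP: vA.
  by rewrite mulmxBr mul_mx_scalar subr_eq0 => /eqP.
by exists v => //; rewrite mulmxBr mul_mx_scalar vA subrr.
Qed.

Lemma herm_eigenvalue_real m (A : 'M[K]_m) (E : K) : A^t* = A ->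
  eigenvalue A E -> exists x : R, E = x%:C%C.
Proof.
move=> hA /eigenvalueP[v vA v0].
suff /complex_realP[x ->] : E \is Num.real by exists x.
have N0 := qform1_gt0 v0; apply/CrealP/(mulIf (lt0r_neq0 N0)).
transitivity (qform v A).
  rewrite /qform mulmx1 -mulmxA (eigenvector_trmxC hA vA).
  by rewrite -scalemxAr [RHS]mxE.
by rewrite /qform vA mulmx1 -scalemxAl [LHS]mxE.
Qed.

(** The product of the two determinants covers both signs of the energy. It describes the absolute
    energies as zeros of one function continuous in [k] and [E] together, without following
    eigenvalues as [k] varies. *)
Definition char_det (kE : 'rV[R]_d * R) : K :=
  \det (H kE.1 - kE.2%:C%C%:M) * \det (H kE.1 - (- kE.2)%:C%C%:M).

Lemma char_det_continuous : continuous char_det.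
Proof.
have [cH _ _] := H_herm.
have cdet (g : R -> R) : continuous g ->
    continuous (fun kE : 'rV[R]_d * R => \det (H kE.1 - (g kE.2)%:C%C%:M)).
  move=> cg; apply: continuous_det => i j kE.
  have -> : (fun kE0 : 'rV[R]_d * R => (H kE0.1 - (g kE0.2)%:C%C%:M) i j) =
      (fun kE0 => H kE0.1 i j - (g kE0.2)%:C%C * (i == j)%:R).
    by apply/funext => kE0; rewrite !mxE mulr_natr.
  apply: cvgB.
    apply: (@continuous_comp _ _ _ (fun kE0 : 'rV[R]_d * R => H kE0.1)
      (fun M : 'M[K]_(2 * (n * 2)) => M i j)); last exact: coord_continuous.
    by apply: (@continuous_comp _ _ _ fst H); [exact: cvg_fst|exact: cH].
  apply: cvgM; last exact: cvg_cst.
  apply: (@continuous_comp _ _ _ (fun kE0 : 'rV[R]_d * R => g kE0.2)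
    (fun x : R => x%:C%C : K)); last exact: continuous_real_complex.
  by apply: (@continuous_comp _ _ _ snd g); [exact: cvg_snd|exact: cg].
have c1 : continuous (fun x : R => x) by move=> x; exact: cvg_id.
have c2 : continuous (fun x : R => - x) by move=> x; apply: cvgN; exact: cvg_id.
by move=> kE; apply: cvgM; [exact: (cdet _ c1)|exact: (cdet _ c2)].
Qed.

Lemma char_det_eq0P k (r : R) :
  char_det (k, r) = 0 <->
  eigenvalue (H k) r%:C%C \/ eigenvalue (H k) (- r)%:C%C.
Proof.
rewrite /char_det /=; split.
  by move=> /eqP; rewrite mulf_eq0 => /orP[] /det_eigenvalueP; [left|right].
by case=> /det_eigenvalueP /eqP ->; rewrite ?mul0r ?mulr0.
Qed.

Lemma normc_of_real (x : R) : ComplexField.Normc.normc (x%:C%C : R[i]) = `|x|.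
Proof. by apply: complexI; exact: normc_real. Qed.

(** Hermiticity makes the eigenvalues real, so a modulus [r] comes from the eigenvalue [r] or
    [- r]. *)
Lemma abs_energiesP (r : R) :
  abs_energies H r <-> 0 <= r /\ exists k, char_det (k, r) = 0.
Proof.
have [_ _ hH] := H_herm; split.
  move=> [E [k Ek] <-].
  have [x xE] := herm_eigenvalue_real (hermsymmxP _ (hH k)) Ek.
  rewrite xE normc_of_real; split=> //; exists k; apply/char_det_eq0P.
  rewrite xE in Ek; case: (ger0P x) => x0.
    by left; exact: Ek.
  by right; rewrite opprK; exact: Ek.
move=> [r0 [k /char_det_eq0P[] Ek]].
  exists r%:C%C; first by exists k; exact: Ek.
  by rewrite normc_of_real ger0_norm.
exists (- r)%:C%C; first by exists k; exact: Ek.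
by rewrite normc_of_real normrN ger0_norm.
Qed.

(** By periodicity the momenta may be confined to a cube, and the energies may be cut off at one
    known value [r1]. The zeros of [char_det] there form a nonempty compact set [D], on which the
    energy coordinate attains its minimum. *)
Lemma energy_gapP :
  abs_energies H (energy_gap H) /\ lbound (abs_energies H) (energy_gap H).
Proof.
have [_ pH hH] := H_herm.
apply: (@xgetPex _ 0 [set E | abs_energies H E /\ lbound (abs_energies H) E]).
(* An eigenvalue exists over an algebraically closed field because the dimension is positive, by
   [n_gt0]. *)
have [E1 E1P] : exists E, eigenvalue (H 0) E.
  by apply/eigenvalue_closed; rewrite !muln_gt0 n_gt0.
pose r1 := ComplexField.Normc.normc (E1 : R[i]).
have [r1_ge0 [k1 k1P]] : 0 <= r1 /\ exists k, char_det (k, r1) = 0.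
  by apply/abs_energiesP; exists E1 => //; exists 0.
have reduce k r : char_det (k, r) = 0 -> exists2 k',
    char_det (k', r) = 0 & forall i, k' 0 i \in `[0, 2 * pi].
  move=> kr; have [k' Hk' k'P] := torus_periodic_reduce k pH.
  by exists k'; [rewrite /char_det /= Hk'; exact: kr|].
pose cube := [set k : 'rV[R]_d | forall i, `[0, 2 * pi]%classic (k 0 i)].
pose D := (cube `*` `[0, r1]%classic) `&` char_det @^-1` [set 0].
have cD : compact D.
  apply: compact_closedI.
    apply: compact_setX; last exact: segment_compact.
    exact: (@rV_compact R d (fun=> `[0, 2 * pi]%classic)
      (fun=> @segment_compact _ _ _)).
  apply: (continuous_closedP _).1; first exact: char_det_continuous.
  apply: accessible_closed_set1; apply: hausdorff_accessible.
  exact: (@norm_hausdorff K K^o).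
have D0 : D !=set0.
  have [k2 k2P k2i] := reduce _ _ k1P.
  by exists (k2, r1); split=> //; split=> //=; rewrite in_itv /= r1_ge0 lexx.
have [|[k r] kr kmin] := compact_EVT_min (f := snd) D0 cD.
  by apply: continuous_subspaceT => -[x y]; exact: cvg_snd.
move: kr; rewrite inE => -[[_ /=]]; rewrite in_itv /= => /andP[r0 rr1] krP.
exists r; split; first by apply/abs_energiesP; split=> //; exists k.
move=> e /abs_energiesP[e0 [k' k'P]].
(* Energies beyond the cutoff [r1] exceed the minimum [r <= r1] anyway. *)
have [er1|/ltW er1] := lerP e r1; last exact: le_trans er1.
have [k2 k2P k2i] := reduce _ _ k'P.
apply: (kmin (k2, e)); rewrite inE; split=> //; split=> //=.
by rewrite in_itv /= e0.
Qed.

(** Since the minimum is attained, the gap is the modulus of an actual eigenvalue, to which the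
    bound applies, rather than the default value 0 of [xget]. *)
Lemma energy_gap_ge (g : R) :
  (forall k E, eigenvalue (H k) E -> g%:C%C <= `|E|) -> g <= energy_gap H.
Proof.
move=> gP; have [[E [k Ek] <-] _] := energy_gapP.
by rewrite -lecR; exact: gP Ek.
Qed.

Lemma energy_gap_le k E : eigenvalue (H k) E -> (energy_gap H)%:C%C <= `|E|.
Proof.
move=> Ek; have [_ lbH] := energy_gapP.
have := lbH (ComplexField.Normc.normc (E : R[i])); rewrite -lecR; apply.
by exists E => //; exists k.
Qed.

End EnergyGap.

(** * The path to the onsite potential *)

Lemma continuous_add (K : numFieldType) (T : topologicalType) (f g : T -> K) :
  continuous f -> continuous g -> continuous (fun x => f x + g x).
Proof. by move=> cf cg x; apply: cvgD; [exact: cf|exact: cg]. Qed.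

Lemma continuous_mul (K : numFieldType) (T : topologicalType) (f g : T -> K) :
  continuous f -> continuous g -> continuous (fun x => f x * g x).
Proof. by move=> cf cg x; apply: cvgM; [exact: cf|exact: cg]. Qed.

Lemma continuous_entry (K : numFieldType) (T : topologicalType) m n
    (f : T -> 'M[K]_(m, n)) i j : continuous f -> continuous (fun x => f x i j).
Proof.
move=> cf x; apply: (@continuous_comp _ _ _ f (fun A : 'M[K]_(m, n) => A i j)).
  exact: cf.
exact: coord_continuous.
Qed.

Section Path.
Variables (R : realType) (d n : nat).
Local Notation K := (Cplx R).
Hypothesis n_gt0 : (0 < n)%N.
Variable H0 : 'rV[R]_d -> 'M[K]_(n * 2).
Hypotheses (H0_herm : ti_hermitian H0) (H0_even : tr_even H0).
Implicit Types (Delta B : 'I_n -> R) (nv : 'I_n -> 'rV[R]_3).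

Lemma swave_continuous Delta B nv :
  continuous (swave_hamiltonian H0 Delta B nv).
Proof.
have [cH0 _ _] := H0_herm; apply: continuous_mx => i j.
(* Pairing and Zeeman field are constant in [k], so their value at the origin stands for all
   momenta. *)
pose M := (1%:M *t zeeman B nv (0 : 'rV[R]_d) +
  pauli_x R *t pairing Delta (0 : 'rV[R]_d)) i j.
have -> : (fun k => swave_hamiltonian H0 Delta B nv k i j) =
    (fun k => pauli_z R (mxtens_unindex i).1 (mxtens_unindex j).1 *
      H0 k (mxtens_unindex i).2 (mxtens_unindex j).2 + M).
  by apply/funext => k; rewrite swaveE -addrA mxE [X in X + _]mxE.
apply: continuous_add; last exact: cst_continuous.
apply: continuous_mul; first exact: cst_continuous.
exact: continuous_entry.
Qed.

Lemma swave_ti_hermitian Delta B nv :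
  ti_hermitian (swave_hamiltonian H0 Delta B nv).
Proof.
split; first exact: swave_continuous.
  move=> k a; rewrite !swaveE; have [_ pH0 _] := H0_herm.
  by rewrite pH0.
by move=> k; apply/hermsymmxP; exact: swave_trmxC.
Qed.

Lemma swave_gap_ge Delta B nv (g : R) :
  (forall i, 0 <= B i) -> (forall i, unit_vector (nv i)) ->
  (forall i, g <= Delta i - B i) ->
  g <= energy_gap (swave_hamiltonian H0 Delta B nv).
Proof.
move=> B0 nv1 gle; apply: (energy_gap_ge n_gt0 (swave_ti_hermitian _ _ _)).
by move=> k E; exact: (swave_eigenvalue_ge H0_herm B0 nv1 gle).
Qed.

Lemma min_site_le (f : 'I_n -> R) i : min_site n_gt0 f <= f i.
Proof. exact: bigmin_le. Qed.

Lemma min_site_gt0 (f : 'I_n -> R) :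
  (forall i, 0 < f i) -> 0 < min_site n_gt0 f.
Proof. by move=> f0; apply/bigmin_gtP; split. Qed.

Lemma max_site_ge (f : 'I_n -> R) i : f i <= max_site n_gt0 f.
Proof. exact: le_bigmax. Qed.

(** A uniform pairing is a scalar matrix, since the site projections sum to the identity. Adding a
    multiple of [tau_x] therefore stays within s-wave systems. *)
Lemma swave_shift Delta B nv (t : R) k :
  swave_hamiltonian H0 (fun i => Delta i + t) B nv k =
  swave_hamiltonian H0 Delta B nv k + t%:C%C *: tau_x R n.
Proof.
rewrite !swaveE /tau_x.
have -> : pairing (fun i => Delta i + t) k = pairing Delta k + t%:C%C%:M.
  rewrite /pairing -scalemx1 -site_diag1 -site_diagZ -site_diagD.
  by congr site_diag; apply/funext => i; rewrite rmorphD /= raddfD /= scalemx1.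
move: (zeeman B nv k) (pairing Delta k) (H0 k) => HM D A.
by rewrite tensmxDr addrA -[t%:C%C%:M]scalemx1 tensmxZr.
Qed.

Lemma swave_shift_gap_ge Delta B nv (t : R) : 0 <= t ->
  gapped (swave_hamiltonian H0 Delta B nv) ->
  energy_gap (swave_hamiltonian H0 Delta B nv) - t <=
  energy_gap (swave_hamiltonian H0 (fun i => Delta i + t) B nv).
Proof.
move=> t0 gH; apply: (energy_gap_ge n_gt0 (swave_ti_hermitian _ _ _)).
move=> k E; rewrite swave_shift rmorphB /=.
apply: shifted_eigenvalue_ge; rewrite ?ler0c //.
- exact: swave_trmxC.
- exact: tau_x_herm.
- exact: tau_x_sqr.
- exact: ltW.
- move=> E' E'k; apply: (energy_gap_le n_gt0 (swave_ti_hermitian _ _ _)).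
  exact: E'k.
Qed.

Lemma affine_ti_hermitian (a b : R) :
  ti_hermitian (fun k => a%:C%C *: H0 k + b%:C%C%:M).
Proof.
have [cH0 pH0 hH0] := H0_herm; split.
- apply: continuous_mx => i j.
  have -> : (fun k' => (a%:C%C *: H0 k' + b%:C%C%:M) i j) =
      (fun k' => a%:C%C * H0 k' i j + (b%:C%C%:M : 'M[K]_(n * 2)) i j).
    by apply/funext => k'; rewrite 2!mxE.
  apply: continuous_add; last exact: cst_continuous.
  apply: continuous_mul; first exact: cst_continuous.
  exact: continuous_entry.
- by move=> k i; rewrite pH0.
- move=> k; apply/hermsymmxP.
  rewrite linearD /= map_mxD linearZ /= map_mxZ tr_scalar_mx map_scalar_mx /=.
  by rewrite !conj_complex (hermsymmxP _ (hH0 k)).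
Qed.

Lemma affine_tr_even (a b : R) : tr_even (fun k => a%:C%C *: H0 k + b%:C%C%:M).
Proof.
apply/funext => k; have /(congr1 (fun f => f k)) := H0_even.
have /(congr1 (fun f => f k)) := @scalar_tr_even R n d b.
rewrite /time_reversal /conj_mx map_mxD map_mxZ /= conj_complex.
move: (sigma_y R n) (b%:C%C%:M : 'M[K]_(n * 2)) (H0 k) (H0 _) => Y D A A' hD hA.
by rewrite mulmxDr mulmxDl hD -scalemxAr -scalemxAl hA.
Qed.

(** The onsite potential is itself s-wave, with [H0 = 1] and no pairing or field, so combining it
    linearly with an s-wave system gives an s-wave system again. *)
Lemma swave_scale Delta B nv (a b : R) k :
  swave_hamiltonian (fun k => a%:C%C *: H0 k + b%:C%C%:M)
    (fun i => a * Delta i) (fun i => a * B i) nv k =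
  a%:C%C *: swave_hamiltonian H0 Delta B nv k + b%:C%C *: onsite_potential n k.
Proof.
rewrite !swaveE /onsite_potential.
have -> : pairing (fun i => a * Delta i) k = a%:C%C *: pairing Delta k.
  rewrite /pairing -site_diagZ; congr site_diag; apply/funext => i.
  by rewrite rmorphM /= scale_scalar_mx.
have -> : zeeman (fun i => a * B i) nv k = a%:C%C *: zeeman B nv k.
  rewrite /zeeman -site_diagZ; congr site_diag; apply/funext => i.
  by rewrite rmorphM /= scalerA.
move: (zeeman B nv k) (pairing Delta k) (H0 k) => HM D A.
rewrite -[b%:C%C%:M]scalemx1 tensmxDr !tensmxZr !scalerDr.
move: (_ *: (_ *t A)) (_ *: (_ *t HM)) (_ *: (_ *t D)) (_ *: (_ *t 1%:M)).
by move=> x y z w; rewrite -!addrA; congr (_ + _); rewrite addrC -!addrA.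
Qed.

(** The anticommutator bound with the Hamiltonian itself, an involution, as [X]: the anticommutator
    is then exactly 2. *)
Lemma onsite_gap_ge : 1 <= energy_gap (@onsite_potential R d n).
Proof.
have tzh : (pauli_z R *t (1%:M : 'M[K]_(n * 2)))^t* = pauli_z R *t 1%:M.
  by rewrite trmxC_tens pauli_z_herm trmx1 map_mx1.
have tz2 : (pauli_z R *t (1%:M : 'M[K]_(n * 2))) *m (pauli_z R *t 1%:M) = 1%:M.
  by rewrite tensmx_mul pauli_z_sqr mulmx1 tens1mx1.
apply: (energy_gap_ge n_gt0 (const_ti_hermitian _ tzh)).
move=> k E; apply: (anticomm_eigenvalue_ge tzh tzh tz2); first exact: rpred1.
move=> v; rewrite tz2 rmorph1 mulr1 raddfMn /= subrr.
by rewrite /qform mulmx0 mul0mx mxE.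
Qed.

End Path.

(** * The two-stage path: raising the pairing, then interpolating linearly *)

Section SwavePath.
Variables (R : realType) (d n : nat).
Local Notation K := (Cplx R).
Hypothesis n_gt0 : (0 < n)%N.
Variable H0 : 'rV[R]_d -> 'M[K]_(n * 2).
Hypotheses (H0_herm : ti_hermitian H0) (H0_even : tr_even H0).
Implicit Types (Delta B : 'I_n -> R) (nv : 'I_n -> 'rV[R]_3).

(** Puts both stages into one continuous formula: on [[0, 1]], [ramp (2 * s)] rises to 1 at
    [s = 1/2] and stays there, while [ramp (2 - 2 * s)] is 1 up to [s = 1/2] and then falls to 0. *)
Definition ramp (x : R) : R := Num.min 1 x.

(* For [s <= 1/2] the pairing grows by [2 s c]; for [1/2 <= s] the result is
   interpolated linearly to the onsite potential. *)
Definition swave_path (c : R) Delta B nv (s : R) :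
    'rV[R]_d -> 'M[K]_(2 * (n * 2)) :=
  let a := ramp (2 - 2 * s) in
  swave_hamiltonian (fun k => a%:C%C *: H0 k + (1 - a)%:C%C%:M)
    (fun i => a * (Delta i + c * ramp (2 * s))) (fun i => a * B i) nv.

Lemma swave_pathE c Delta B nv s k :
  swave_path c Delta B nv s k =
  (ramp (2 - 2 * s))%:C%C *:
    (swave_hamiltonian H0 Delta B nv k +
     (c * ramp (2 * s))%:C%C *: tau_x R n) +
  (1 - ramp (2 - 2 * s))%:C%C *: onsite_potential n k.
Proof. by rewrite /swave_path swave_scale swave_shift. Qed.

Lemma ramp_continuous (p q : R) : continuous (fun s : R => ramp (p + q * s)).
Proof.
move=> s; apply: (@continuous_min R R (fun=> 1) (fun x => p + q * x)).
  exact: cvg_cst.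
apply: continuous_add; first exact: cst_continuous.
apply: continuous_mul; first exact: cst_continuous.
by move=> ?; exact: cvg_id.
Qed.

Lemma swave_path_continuous c Delta B nv :
  continuous (fun sk : R * 'rV[R]_d => swave_path c Delta B nv sk.1 sk.2).
Proof.
have cfst (g : R -> R) : continuous g ->
    continuous (fun sk : R * 'rV[R]_d => (g sk.1)%:C%C : K).
  move=> cg sk; apply: (@continuous_comp _ _ _ (fun sk : R * 'rV[R]_d => g sk.1)
    (fun x : R => x%:C%C : K)); last exact: continuous_real_complex.
  by apply: (@continuous_comp _ _ _ fst g); [exact: cvg_fst|exact: cg].
have ca : continuous (fun s : R => ramp (2 - 2 * s)).
  have := @ramp_continuous 2 (- 2).
  by under [X in continuous X -> _]eq_fun do rewrite mulNr.
have cu : continuous (fun s : R => ramp (2 * s)).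
  have := @ramp_continuous 0 2.
  by under [X in continuous X -> _]eq_fun do rewrite add0r.
apply: continuous_mx => i j.
pose H := swave_hamiltonian H0 Delta B nv.
have cH : continuous H by exact: swave_continuous.
have -> : (fun sk : R * 'rV[R]_d => swave_path c Delta B nv sk.1 sk.2 i j) =
    (fun sk => (ramp (2 - 2 * sk.1))%:C%C *
       (H sk.2 i j + (c * ramp (2 * sk.1))%:C%C * tau_x R n i j) +
       (1 - ramp (2 - 2 * sk.1))%:C%C * onsite_potential n (0 : 'rV[R]_d) i j).
  apply/funext => sk; rewrite swave_pathE -/H.
  move: (H _) (tau_x R n) => M X; rewrite /onsite_potential.
  by move: (pauli_z R *t _) => O; rewrite !mxE.
apply: continuous_add.
  apply: continuous_mul; first exact: (cfst _ ca).
  apply: continuous_add.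
    apply: continuous_entry => sk.
    by apply: (@continuous_comp _ _ _ snd H); [exact: cvg_snd|exact: cH].
  apply: continuous_mul; last exact: cst_continuous.
  apply: (cfst (fun s => c * ramp (2 * s))).
  by apply: continuous_mul => //; exact: cst_continuous.
apply: continuous_mul; last exact: cst_continuous.
apply: (cfst (fun s => 1 - ramp (2 - 2 * s))) => s.
by apply: cvgB; [exact: cvg_cst|exact: ca].
Qed.

Lemma swave_path_BdG c Delta B nv s :
  BdG_hamiltonian (swave_path c Delta B nv s).
Proof.
by apply: swave_BdG; [exact: affine_ti_hermitian|exact: affine_tr_even].
Qed.

Lemma swave_path_low c Delta B nv s : s <= 2^-1 ->
  swave_path c Delta B nv s =
  swave_hamiltonian H0 (fun i => Delta i + c * (2 * s)) B nv.
Proof.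
move=> s2; apply/funext => k; rewrite swave_pathE swave_shift.
have -> : ramp (2 - 2 * s) = 1 by apply/min_idPl; lra.
have -> : ramp (2 * s) = 2 * s by apply/min_idPr; lra.
by rewrite subrr scale0r addr0 scale1r.
Qed.

Lemma swave_path0 c Delta B nv :
  swave_path c Delta B nv 0 = swave_hamiltonian H0 Delta B nv.
Proof.
have le0 : 0 <= 2^-1 :> R by rewrite invr_ge0 ler0n.
rewrite (swave_path_low _ _ _ _ le0).
by have -> : (fun i => Delta i + c * (2 * 0)) = Delta
  by apply/funext => i; rewrite !mulr0 addr0.
Qed.

Lemma swave_path1 c Delta B nv :
  swave_path c Delta B nv 1 = @onsite_potential R d n.
Proof.
apply/funext => k; rewrite swave_pathE.
have -> : ramp (2 - 2 * 1) = 0 by rewrite mulr1 subrr; apply/min_idPr.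
by rewrite scale0r add0r subr0 scale1r.
Qed.

(** The first stage is covered by the hypothesis on shifted pairings. In the second, pairing and
    field carry a common factor [a], so the gap is at least [a] times the minimum of
    [Delta i + c - B i]. *)
Lemma swave_path_gapped c Delta B nv s : 0 <= c ->
  (forall i, 0 <= B i) -> (forall i, unit_vector (nv i)) ->
  (forall i, 0 < Delta i + c - B i) ->
  (forall t, 0 <= t <= c ->
     gapped (swave_hamiltonian H0 (fun i => Delta i + t) B nv)) ->
  s \in `[0, 1] -> gapped (swave_path c Delta B nv s).
Proof.
move=> c0 B0 nv1 DB gt; rewrite in_itv /= => /andP[s0 s1].
have [s2|s2] := lerP s 2^-1.
  (* The shift here is [c * (2 * s)], which lies between 0 and [c]. *)
  by rewrite swave_path_low //; apply: gt; nra.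
(* At the endpoint [a] vanishes and the scaled bound would only give 0, so the onsite potential is
   treated by itself. *)
have [->|sn1] := eqVneq s 1.
  by rewrite swave_path1; exact: lt_le_trans (onsite_gap_ge R d n_gt0).
have {sn1} s1 : s < 1 by rewrite lt_neqAle sn1.
have aE : ramp (2 - 2 * s) = 2 - 2 * s by apply/min_idPr; lra.
have uE : ramp (2 * s) = 1 by apply/min_idPl; lra.
rewrite /gapped /swave_path aE uE mulr1.
set a := 2 - 2 * s; have a0 : 0 < a by rewrite /a; lra.
pose g := a * min_site n_gt0 (fun i => Delta i + c - B i).
have g0 : 0 < g by rewrite mulr_gt0 // min_site_gt0.
apply: (lt_le_trans g0); apply: (energy_gap_ge n_gt0).
  exact: (swave_ti_hermitian (affine_ti_hermitian H0_herm _ _)).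
have aB0 i : 0 <= a * B i by rewrite mulr_ge0 // ltW.
have gle i : g <= a * (Delta i + c) - a * B i.
  rewrite -mulrBr ler_pM2l //.
  exact: (min_site_le n_gt0 (fun i => Delta i + c - B i)).
move=> k E.
exact: (swave_eigenvalue_ge (affine_ti_hermitian H0_herm _ _) aB0 nv1 gle).
Qed.

(** Symmetry of the initial Hamiltonian forces its Zeeman term to vanish, and along the path that
    term is only rescaled. *)
Lemma swave_path_tr_symmetric c Delta B nv s :
  BdG_tr_symmetric (swave_hamiltonian H0 Delta B nv) ->
  BdG_tr_symmetric (swave_path c Delta B nv s).
Proof.
move=> trH; apply/funext => k.
rewrite BdG_time_reversal_swave; last exact: affine_tr_even.
have := etrans (esym (BdG_time_reversal_swave Delta B nv k H0_even))
  (congr1 (fun f => f k) trH).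
have -> : zeeman (fun i => ramp (2 - 2 * s) * B i) nv k =
    (ramp (2 - 2 * s))%:C%C *: zeeman B nv k.
  rewrite /zeeman -site_diagZ; congr site_diag; apply/funext => i.
  by rewrite rmorphM /= scalerA.
rewrite -/(swave_path c Delta B nv s).
move: (swave_hamiltonian H0 Delta B nv k) (swave_path _ _ _ _ _ _).
move: (zeeman B nv k) => Z H1 H2 /(canRL (subrK _)) => e.
have {e} : 2 *: (1%:M *t Z) = 0 :> 'M[K]_(2 * (n * 2)).
  by apply: (addrI H1); rewrite addr0 -e.
by move=> Z0; rewrite tensmxZr scalerA mulrC -scalerA Z0 scaler0 subr0.
Qed.

(** Common criterion for both parts: [c] is the amount of pairing added before the interpolation
    starts, and [c = 0] makes the first stage constant. *)
Lemma swave_trivial c Delta B nv : 0 <= c ->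
  (forall i, 0 <= B i) -> (forall i, unit_vector (nv i)) ->
  (forall i, 0 < Delta i + c - B i) ->
  (forall t, 0 <= t <= c ->
     gapped (swave_hamiltonian H0 (fun i => Delta i + t) B nv)) ->
  topologically_trivial (swave_hamiltonian H0 Delta B nv).
Proof.
move=> c0 B0 nv1 DB gt.
have gs s := swave_path_gapped (s := s) c0 B0 nv1 DB gt.
split.
  by rewrite -(swave_path0 c); apply: gs; rewrite in_itv /= lexx ler01.
exists (swave_path c Delta B nv); split.
- by apply: continuous_subspaceT; exact: swave_path_continuous.
- by move=> s s01; split; [exact: swave_path_BdG|exact: gs].
- by split; [exact: swave_path0|exact: swave_path1].
- by move=> trH s _; exact: swave_path_tr_symmetric.
Qed.

End SwavePath.

(** * Gap bound and triviality of s-wave systems *)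

Theorem mainTheorem4 (R : realType) (d n : nat) (n_gt0 : (0 < n)%N)
    (H0 : 'rV[R]_d -> 'M[Cplx R]_(n * 2))
    (Delta B : 'I_n -> R) (nv : 'I_n -> 'rV[R]_3)
    (H0_herm : ti_hermitian H0) (H0_even : tr_even H0)
    (Delta_ge0 : forall i, 0 <= Delta i) (B_ge0 : forall i, 0 <= B i)
    (nv_unit : forall i, unit_vector (nv i)) :
  let H := swave_hamiltonian H0 Delta B nv in
  let EG := energy_gap H in
  ((forall i, 0 < Delta i - B i) ->
     topologically_trivial H /\ min_site n_gt0 (fun i => Delta i - B i) <= EG)
  /\
  (0 < EG -> max_site n_gt0 (fun i => B i - Delta i) < EG ->
     topologically_trivial H).
Proof.
move=> H EG; split=> [DB|EG0 maxEG].
  have gap_ge : min_site n_gt0 (fun i => Delta i - B i) <= EG.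
    apply: (swave_gap_ge n_gt0) => // i.
    exact: (min_site_le n_gt0 (fun i => Delta i - B i)).
  split; last exact: gap_ge.
  apply: (swave_trivial n_gt0 H0_herm H0_even (lexx 0) B_ge0 nv_unit) => [i|t].
    by rewrite addr0.
  (* With [c = 0] the only shift is [t = 0]. *)
  rewrite -eq_le => /eqP <-.
  have -> : (fun i => Delta i + 0) = Delta by apply/funext => i; rewrite addr0.
  exact: lt_le_trans (min_site_gt0 n_gt0 DB) gap_ge.
set M := max_site _ _ in maxEG.
(* The midpoint lies strictly between [M] and [EG]; the maximum with 0 makes [c] nonnegative and
   keeps it below [EG] because [EG > 0]. *)
pose c := Num.max 0 ((M + EG) / 2).
have cEG : c < EG by rewrite gt_max EG0 /=; lra.
have Mc : M < c by rewrite lt_max; apply/orP; right; lra.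
have c0 : 0 <= c by rewrite le_max lexx.
apply: (swave_trivial n_gt0 H0_herm H0_even c0 B_ge0 nv_unit) => [i|t].
  have := max_site_ge n_gt0 (fun i => B i - Delta i) i.
  by rewrite -/M /=; lra.
move=> /andP[t0 tc].
(* A shift by [t <= c] costs at most [t] of the gap, and [c < EG]. *)
apply: (lt_le_trans _ (swave_shift_gap_ge n_gt0 H0_herm t0 EG0)).
by rewrite subr_gt0 (le_lt_trans tc).
Qed.
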